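(* Let $C\subseteq\mathbb{Z}_2^n$ be a self-complementary binary code of length $n$ and degree $s$, and let $S(C)=\{i\in\{1,\ldots,n\}:A_i(C)\ne 0\}$. Write \[ \overline{\alpha}_C(z)=\prod_{i\in S(C)\setminus\{n\}}\Big(1-\frac{z}{i}\Big)=\sum_{i=0}^{s-1}\alpha_iK_i(z) \] (the expansion is unique since $K_i$ has degree $i$; moreover $\alpha_i=0$ unless $i\equiv s-1\pmod 2$). Put $\delta=0$ if $s$ is odd and $\delta=1$ if $s$ is even. If all the $\alpha_i$ with $i\equiv s-1\pmod 2$ are nonnegative and $\alpha_\delta>0$, then \[ |C|\le\Big\lfloor \frac{2}{\alpha_\delta}\Big\rfloor . \]
   Context: A binary code of length $n$ is a subset of $\mathbb{Z}_2^n$; $d(x,y)$ denotes Hamming distance. $C$ is self-complementary if $x+\mathbf{1}\in C$ for all $x\in C$ ($\mathbf{1}$ the all-one vector). $A_i(C)=\frac{1}{|C|}|\{(x,x')\in C\times C: d(x,x')=i\}|$, and the degree of $C$ is $|\{i\in\{1,\ldots,n\}:A_i(C)\neq0\}|$. The Krawtchouk polynomials (for length $n$) are $K_i(z)=\sum_{j=0}^i(-1)^j\binom{z}{j}\binom{n-z}{i-j}$. *)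

(* Defs.v *)
From mathcomp Require Import all_boot all_order all_algebra.

Set Implicit Arguments.
Unset Strict Implicit.
Unset Printing Implicit Defensive.

Import Order.TTheory GRing.Theory Num.Theory.
Local Open Scope ring_scope.

Section Codes.
Variable n : nat.
Implicit Types (x y : 'rV['Z_2]_n) (C : {set 'rV['Z_2]_n}).

Definition hamming_dist x y : nat := #|[set j | x 0 j != y 0 j]|.

Definition self_complementary C : Prop :=
  forall x, x \in C -> x + const_mx 1 \in C.

(* For empty C the division by zero yields 0, so all A_i vanish. *)
Definition dist_distr C (i : nat) : rat :=
  #|[set p in setX C C | hamming_dist p.1 p.2 == i]|%:R / #|C|%:R.

(* A subset of {0, ..., n}, so that n itself is the index ord_max. *)
Definition distances C : {set 'I_n.+1} :=
  [set i : 'I_n.+1 | (0 < i)%N && (dist_distr C i != 0)].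

Definition degree C : nat := #|distances C|.

End Codes.

Section Polynomials.
Variable R : fieldType.

(* p (p - 1) ... (p - j + 1) / j!, the binomial with a polynomial on top. *)
Definition poly_binom (p : {poly R}) (j : nat) : {poly R} :=
  (j`!%:R)^-1 *: \prod_(k < j) (p - k%:R%:P).

Definition krawtchouk (n i : nat) : {poly R} :=
  \sum_(j < i.+1)
    (-1) ^+ j *: (poly_binom 'X j * poly_binom (n%:R%:P - 'X) (i - j)).

Definition reduced_annihilator n (C : {set 'rV['Z_2]_n}) : {poly R} :=
  \prod_(i in distances C :\ ord_max) (1 - (i%:R)^-1 *: 'X).

Definition krawtchouk_expansion n (C : {set 'rV['Z_2]_n}) (alpha : nat -> R) :=
  reduced_annihilator C = \sum_(i < degree C) alpha i *: krawtchouk n i.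

End Polynomials.

(* Main.v *)
(* Let f be the reduced annihilator and d the distance of two codewords. Since C
   is self-complementary, the roots of f are symmetric about n/2, which together
   with K_i(n - z) = (-1)^i K_i(z) gives the parity of the expansion. For the
   bound, sum f(d) K_delta(d) over all pairs of codewords. Only d = 0 and d = n
   survive, and the factor K_delta gives both the same sign, so the sum is
   2 |C| binom(n, delta). Conversely K_i(d(x, y)) is the sum of the characters
   chi_U(x) chi_U(y) over |U| = i, so the sum of K_i(d) K_delta(d) is a sum of
   squares, which for i = delta is at least binom(n, delta) |C|^2. Using the
   product with K_delta treats both parities of s at once, without the
   three-term recurrence. *)
Require Import Defs.
From mathcomp Require Import all_boot all_order all_algebra.

Set Implicit Arguments.
Unset Strict Implicit.
Unset Printing Implicit Defensive.

Import Order.TTheory GRing.Theory Num.Theory.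
Local Open Scope ring_scope.

(** * Krawtchouk polynomials: values at integers, reflection, exact degree *)

Lemma prod_subr_ffact (R : nzRingType) (d j : nat) :
  \prod_(k < j) (d%:R - k%:R) = (d ^_ j)%:R :> R.
Proof.
elim: j => [|j IHj]; first by rewrite big_ord0 ffactn0.
rewrite big_ord_recr IHj ffactnSr natrM /=.
(* For [d < j] the truncated [d - j] is not the new factor, but then [d ^_ j] is already 0. *)
have [le_jd | lt_dj] := leqP j d; first by rewrite natrB.
by rewrite ffact_small ?mul0r.
Qed.

Lemma horner_poly_binom (R : numFieldType) (p : {poly R}) (x : R) (d j : nat) :
  p.[x] = d%:R -> (poly_binom p j).[x] = 'C(d, j)%:R.
Proof.
move=> px; rewrite hornerZ horner_prod.
under eq_bigr => k _ do rewrite hornerD hornerN hornerC px.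
rewrite prod_subr_ffact -bin_ffact natrM mulrC mulfK //.
by rewrite pnatr_eq0 -lt0n fact_gt0.
Qed.

Lemma horner_krawtchouk (R : numFieldType) (n d i : nat) : (d <= n)%N ->
  (krawtchouk R n i).[d%:R] =
    \sum_(j < i.+1) (-1) ^+ j * ('C(d, j)%:R * 'C(n - d, i - j)%:R).
Proof.
move=> le_dn; rewrite horner_sum; apply: eq_bigr => j _.
rewrite hornerZ hornerM (@horner_poly_binom _ _ _ d) ?hornerX //.
by rewrite (@horner_poly_binom _ _ _ (n - d)) // !hornerE natrB.
Qed.

Lemma comp_poly_binom (R : fieldType) (p q : {poly R}) (j : nat) :
  poly_binom p j \Po q = poly_binom (p \Po q) j.
Proof.
rewrite /poly_binom comp_polyZ rmorph_prod /=; congr (_ *: _).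
by apply: eq_bigr => k _; rewrite comp_polyB comp_polyC.
Qed.

(** The substitution exchanges the two binomials of each summand; the reversal [j -> i - j] puts
    them back and turns the sign [(-1)^j] into [(-1)^(i - j)]. *)
Lemma krawtchouk_reflect (R : fieldType) (n i : nat) :
  krawtchouk R n i \Po (n%:R%:P - 'X) = (-1) ^+ i *: krawtchouk R n i.
Proof.
rewrite /krawtchouk raddf_sum /= (reindex_inj rev_ord_inj) scaler_sumr.
apply: eq_bigr => j _; have le_ji : (j <= i)%N by rewrite -ltnS.
rewrite comp_polyZ comp_polyM !comp_poly_binom comp_polyB comp_polyC comp_polyX.
rewrite /= subSS subKn // subKr scalerA mulrC [poly_binom 'X j * _]mulrC.
by rewrite -signr_odd oddB // signr_addb !signr_odd.
Qed.

(** Only size bounds are assumed, so this applies to factors whose top coefficient is not known to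
    be nonzero. *)
Lemma coefM_top (R : nzSemiRingType) (p q : {poly R}) (m k : nat) :
  (size p <= m.+1)%N -> (size q <= k.+1)%N -> (p * q)`_(m + k) = p`_m * q`_k.
Proof.
move=> szp szq; have lt_m : (m < (m + k).+1)%N by rewrite ltnS leq_addr.
rewrite coefM (bigD1 (Ordinal lt_m)) //= addKn big1 ?addr0 // => j.
rewrite -val_eqE /= neq_ltn => /orP[lt_jm | lt_mj].
  rewrite [q`__]nth_default ?mulr0 // (leq_trans szq) // ltn_subRL.
  by rewrite addnC addnC ltn_add2r.
by rewrite nth_default ?mul0r // (leq_trans szp).
Qed.

Lemma poly_binom_top (R : fieldType) (p : {poly R}) (j : nat) :
  (size p <= 2)%N ->
  (size (poly_binom p j) <= j.+1)%N /\ (poly_binom p j)`_j = p`_1 ^+ j / j`!%:R.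
Proof.
move=> szp; rewrite /poly_binom coefZ mulrC.
suff [sz_prod ->]: (size (\prod_(k < j) (p - k%:R%:P))%R <= j.+1)%N
   /\ (\prod_(k < j) (p - k%:R%:P))`_j = p`_1 ^+ j.
  by split=> //; apply: leq_trans (size_scale_leq _ _) _.
have sz_fac k : (size (p - k%:R%:P)%R <= 2)%N.
  rewrite (leq_trans (size_polyD _ _)) // geq_max szp size_polyN.
  by rewrite (leq_trans (size_polyC_leq1 _)).
elim: j => [|j [IHsz IHcoef]]; first by rewrite big_ord0 size_poly1 coef1.
rewrite big_ord_recr /=; split.
  rewrite (leq_trans (size_polyMleq _ _)) // -subn1 leq_subLR.
  by rewrite (leq_trans (leq_add IHsz (sz_fac j))) // addn2.
by rewrite -[in LHS]addn1 coefM_top // IHcoef coefB coefC subr0 exprSr.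
Qed.

Lemma size_krawtchouk (R : numFieldType) (n i : nat) :
  size (krawtchouk R n i) = i.+1.
Proof.
have szX : (size ('X : {poly R}) <= 2)%N by rewrite size_polyX.
have szN : (size (n%:R%:P - 'X : {poly R})%R <= 2)%N.
  by rewrite -opprB size_polyN size_XsubC.
apply/eqP; rewrite eqn_leq; apply/andP; split.
  apply: leq_trans (size_sum _ _ _) _; apply/bigmax_leqP => j _.
  have le_ji : (j <= i)%N by rewrite -ltnS.
  apply: leq_trans (size_scale_leq _ _) _.
  rewrite (leq_trans (size_polyMleq _ _)) // -subn1 leq_subLR.
  have [sz1 _] := poly_binom_top j szX; have [sz2 _] := poly_binom_top (i - j) szN.
  by rewrite (leq_trans (leq_add sz1 sz2)) // addSn addnS subnKC.
have: (krawtchouk R n i)`_i != 0; last first.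
  by apply: contraR; rewrite -leqNgt => ?; rewrite nth_default.
(* The sign [(-1)^(i - j)] from the top coefficient in [n - X] merges with [(-1)^j], so all summands
   share the sign [(-1)^i] and cannot cancel. *)
have ->: (krawtchouk R n i)`_i =
    (-1) ^+ i * \sum_(j < i.+1) (j`!%:R^-1 * (i - j)`!%:R^-1).
  rewrite coef_sum mulr_sumr; apply: eq_bigr => j _.
  have le_ji : (j <= i)%N by rewrite -ltnS.
  have [sz1 cf1] := poly_binom_top j szX.
  have [sz2 cf2] := poly_binom_top (i - j) szN.
  rewrite coefZ; have := coefM_top sz1 sz2; rewrite subnKC // => ->.
  rewrite cf1 cf2 coefB coefC !coefX sub0r expr1n mul1r.
  by rewrite mulrCA [(-1) ^+ j * (_ * _)]mulrA -exprD subnKC // [RHS]mulrCA.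
rewrite mulf_neq0 ?signr_eq0 // gt_eqF // big_ord_recl ltr_pwDl //.
  by rewrite mulr_gt0 // invr_gt0 ltr0n fact_gt0.
by apply: sumr_ge0 => j _; rewrite mulr_ge0 // invr_ge0 ler0n.
Qed.

(** * Existence and uniqueness of expansions in a family with one polynomial per degree *)

Lemma graded_poly_free (R : fieldType) (P : nat -> {poly R}) (a : nat -> R) m :
  (forall i, size (P i) = i.+1) ->
  \sum_(i < m) a i *: P i = 0 -> forall i, (i < m)%N -> a i = 0.
Proof.
move=> szP; elim: m => // m IHm; rewrite big_ord_recr /= => sum0 i.
have am0 : a m = 0.
  have /(congr1 (fun p : {poly R} => p`_m)) := sum0.
  rewrite coefD coefZ coef0 coef_sum big1 ?add0r => [/eqP|j _]; last first.
    by rewrite coefZ nth_default ?mulr0 // szP.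
  rewrite mulf_eq0 => /orP[/eqP // | /eqP Pm0].
  have: lead_coef (P m) = 0 by rewrite /lead_coef szP.
  by move/eqP; rewrite lead_coef_eq0 -size_poly_eq0 szP.
rewrite ltnS leq_eqVlt => /predU1P[-> // |]; apply: IHm.
by rewrite am0 scale0r addr0 in sum0.
Qed.

Lemma graded_poly_span (R : fieldType) (P : nat -> {poly R}) m (p : {poly R}) :
  (forall i, size (P i) = i.+1) -> (size p <= m)%N ->
  exists a : nat -> R, p = \sum_(i < m) a i *: P i.
Proof.
move=> szP; elim: m p => [|m IHm] p szp.
  by exists (fun=> 0); rewrite big_ord0; apply/eqP; rewrite -size_poly_leq0.
have Pm_neq0 : (P m)`_m != 0.
  have := lead_coef_eq0 (P m).
  by rewrite -size_poly_eq0 szP /lead_coef szP => /= ->.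
pose c := p`_m / (P m)`_m.
have [|a def_p] := IHm (p - c *: P m).
  apply/leq_sizeP => j; rewrite leq_eqVlt coefB coefZ => /predU1P[<- | lt_mj].
    by rewrite divfK ?subrr.
  by rewrite !nth_default ?szP ?mulr0 ?subr0 // (leq_trans szp).
exists (fun i => if i == m then c else a i).
rewrite big_ord_recr /= eqxx -[LHS](subrK (c *: P m)) def_p; congr (_ + _).
by apply: eq_bigr => i _; rewrite ltn_eqF.
Qed.

(** * Krawtchouk values as character sums, and the resulting positivity *)

Lemma coef_1DcX_exp (R : comNzRingType) (c : R) (m j : nat) :
  ((1 + c *: 'X) ^+ m)`_j = c ^+ j * 'C(m, j)%:R.
Proof.
rewrite exprDn coef_sum.
under eq_bigr => k _.
  rewrite expr1n mul1r exprZn coefMn coefZ coefXn.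
  over.
have [le_jm | lt_mj] := leqP j m.
  rewrite (bigD1 (Ordinal (le_jm : j < m.+1)%N)) //= eqxx mulr1 mulr_natr.
  rewrite big1 ?addr0 // => k; rewrite -val_eqE /= eq_sym => /negbTE->.
  by rewrite mulr0 mul0rn.
rewrite bin_small // mulr0 big1 // => k _.
by rewrite gtn_eqF ?mulr0 ?mul0rn // (leq_ltn_trans _ lt_mj) // -ltnS.
Qed.

(* Both sides are the coefficient of [X^i] in [(1 - X)^d (1 + X)^(n - d)]. *)
Lemma sum_sign_cardI (R : numFieldType) (n i : nat) (D : {set 'I_n}) :
  \sum_(U : {set 'I_n} | #|U| == i) (-1) ^+ #|U :&: D| =
    (krawtchouk R n i).[#|D|%:R].
Proof.
have le_Dn : (#|D| <= n)%N by rewrite -[n in leqRHS]card_ord max_card.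
rewrite horner_krawtchouk //.
pose c j : R := if j \in D then -1 else 1.
have prodE : \prod_j (c j *: 'X + 1) =
    (1 + -1 *: 'X) ^+ #|D| * (1 + 1 *: 'X) ^+ (n - #|D|) :> {poly R}.
  rewrite (bigID (mem D)) /=; congr (_ * _).
    by rewrite -prodr_const; apply: eq_bigr => j Dj; rewrite /c Dj addrC.
  have -> : (n - #|D| = #|~: D|)%N by rewrite [RHS]cardsCs setCK card_ord.
  rewrite -prodr_const; apply: eq_big => j; first by rewrite inE.
  by move/negbTE=> Dj; rewrite /c Dj addrC.
(* Expanding the product over [j], the set [U] collects the factors that contribute their [X]
   term. *)
have := congr1 (fun p : {poly R} => p`_i) prodE; rewrite coefM bigA_distr coef_sum.
under [RHS]eq_bigr => j _ do rewrite !coef_1DcX_exp expr1n mul1r -mulrA.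
move=> <-; rewrite big_mkcond /=; apply: eq_bigr => U _.
rewrite -big_mkcond /=.
have -> : \prod_(j in U) (c j *: 'X) = (-1) ^+ #|U :&: D| *: 'X^(#|U|) :> {poly R}.
  rewrite scaler_prod prodr_const; congr (_ *: _).
  rewrite (bigID (mem D)) /= [X in _ * X]big1 ?mulr1 => [|j /andP[_ /negbTE Dj]].
    rewrite -prodr_const; apply: eq_big => j; first by rewrite inE.
    by case/andP=> _ Dj; rewrite /c Dj.
  by rewrite /c Dj.
by rewrite coefZ coefXn eq_sym; case: eqP; rewrite ?mulr1 ?mulr0.
Qed.

Section Characters.
Variables (R : numFieldType) (n : nat).
Implicit Types (x y : 'rV['Z_2]_n) (U V : {set 'I_n}).

Definition binary_char U x : R := \prod_(j in U) (-1) ^+ (x 0 j : nat).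

Lemma binary_char_sqr U x : binary_char U x * binary_char U x = 1.
Proof.
rewrite -big_split big1 // => j _ /=.
by rewrite -exprD addnn -signr_odd odd_double.
Qed.

(** Coordinates where [x] and [y] agree contribute a squared sign; each of the others contributes
    -1. *)
Lemma binary_charM U x y :
  binary_char U x * binary_char U y = (-1) ^+ #|U :&: [set j | x 0 j != y 0 j]|.
Proof.
set D := [set j | _]; rewrite -big_split (bigID (mem D)) /=.
rewrite [X in _ * X]big1 ?mulr1 => [|j].
  rewrite -prodr_const; apply: eq_big => j; first by rewrite in_setI.
  case/andP=> _; rewrite inE; case: (x 0 j) (y 0 j) =>
    [[|[|a]] lta] [[|[|b]] ltb] // _.
    by rewrite mul1r.
  by rewrite mulr1.
case/andP=> _; rewrite inE negbK => /eqP->.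
by rewrite -exprD addnn -signr_odd odd_double.
Qed.

(** This makes [K_i(d(x, y))] a positive semidefinite kernel in [x] and [y], the source of every
    inequality below. *)
Lemma sum_binary_char i x y :
  \sum_(U : {set 'I_n} | #|U| == i) binary_char U x * binary_char U y =
    (krawtchouk R n i).[(hamming_dist x y)%:R].
Proof.
by under eq_bigr => U _ do rewrite binary_charM; rewrite sum_sign_cardI.
Qed.

Lemma krawtchouk_at0 i : (krawtchouk R n i).[0] = 'C(n, i)%:R.
Proof.
have := sum_sign_cardI R i (set0 : {set 'I_n}); rewrite cards0 => <-.
under eq_bigr => U _ do rewrite setI0 cards0 expr0.
by rewrite -[n in RHS]card_ord -card_draws -sum1dep_card natr_sum.
Qed.

(** Expand both factors into characters. For fixed [U] and [V] the summand is [h(x) h(y)] with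
    [h = chi_U chi_V], so the double sum over [C] is a square. *)
Lemma sum_krawtchoukM (C : {set 'rV['Z_2]_n}) i k :
  \sum_(x in C) \sum_(y in C) (krawtchouk R n i).[(hamming_dist x y)%:R] *
     (krawtchouk R n k).[(hamming_dist x y)%:R] =
  \sum_(U : {set 'I_n} | #|U| == i) \sum_(V : {set 'I_n} | #|V| == k)
    (\sum_(x in C) binary_char U x * binary_char V x) ^+ 2.
Proof.
under eq_bigr => x _.
  under eq_bigr => y _ do rewrite -!sum_binary_char big_distrlr.
  over.
under eq_bigr => x _ do rewrite exchange_big /=.
rewrite exchange_big /=; apply: eq_bigr => U _.
under eq_bigr => x _ do rewrite exchange_big /=.
rewrite exchange_big /=; apply: eq_bigr => V _.
rewrite expr2 big_distrlr /=; apply: eq_bigr => x _; apply: eq_bigr => y _.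
by rewrite mulrACA.
Qed.

End Characters.

Section Bounds.
Variables (R : realFieldType) (n : nat) (C : {set 'rV['Z_2]_n}).

Lemma sum_krawtchoukM_ge0 i k :
  0 <= \sum_(x in C) \sum_(y in C) (krawtchouk R n i).[(hamming_dist x y)%:R] *
     (krawtchouk R n k).[(hamming_dist x y)%:R].
Proof.
rewrite sum_krawtchoukM.
by apply: sumr_ge0 => U _; apply: sumr_ge0 => V _; rewrite sqr_ge0.
Qed.

(* The pairs [U = V] alone contribute the right-hand side. *)
Lemma sum_krawtchouk_sqr_ge i :
  'C(n, i)%:R * #|C|%:R ^+ 2 <=
    \sum_(x in C) \sum_(y in C) (krawtchouk R n i).[(hamming_dist x y)%:R] *
      (krawtchouk R n i).[(hamming_dist x y)%:R].
Proof.
rewrite sum_krawtchoukM -[n in 'C(n, _)]card_ord -card_draws -sum1dep_card.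
rewrite natr_sum mulr_suml; apply: ler_sum => U szU; rewrite (bigD1 U) //= mul1r.
under [X in X ^+ 2 + _]eq_bigr => x _ do rewrite binary_char_sqr.
rewrite sumr_const ler_wpDr //.
by apply: sumr_ge0 => V _; rewrite sqr_ge0.
Qed.

End Bounds.

(** * Distances in a self-complementary code *)

Section Distances.
Variables (n : nat).
Implicit Types (x y : 'rV['Z_2]_n) (C : {set 'rV['Z_2]_n}) (i : 'I_n.+1).

Lemma hamming_dist_leq x y : (hamming_dist x y <= n)%N.
Proof. by rewrite -[n in leqRHS]card_ord max_card. Qed.

Lemma hamming_dist_eq0 x y : (hamming_dist x y == 0%N) = (x == y).
Proof.
apply/eqP/eqP => [/cards0_eq dist0 | ->].
  apply/rowP => j; apply/eqP; apply: contraFT (in_set0 j) => neq_xy.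
  by rewrite -dist0 inE.
by apply: eq_card0 => j; rewrite inE eqxx.
Qed.

(** Adding the all-one vector to [y] swaps the coordinates of agreement with those of
    disagreement. *)
Lemma hamming_dist_complement x y :
  hamming_dist x (y + const_mx 1) = (n - hamming_dist x y)%N.
Proof.
rewrite [LHS]cardsCs card_ord; congr (n - #|pred_of_set _|)%N.
apply/setP => j; rewrite !inE !mxE.
by case: (x 0 j) (y 0 j) => [[|[|a]] lta] [[|[|b]] ltb].
Qed.

Lemma distancesP C i :
  reflect ((0 < i)%N /\ exists x y, [/\ x \in C, y \in C & hamming_dist x y = i])
          (i \in distances C).
Proof.
rewrite inE; apply: (iffP andP) => -[i_gt0].
  rewrite mulf_eq0 negb_or pnatr_eq0 -lt0n card_gt0 => /andP[/set0Pn[[x y]] + _].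
  rewrite inE in_setX => /andP[/andP[Cx Cy] /eqP dxy].
  by split=> //; exists x, y.
case=> x [y [Cx Cy dxy]]; split=> //; rewrite mulf_neq0 //.
  rewrite pnatr_eq0 -lt0n card_gt0; apply/set0Pn; exists (x, y).
  by rewrite inE in_setX Cx Cy /= dxy.
by rewrite invr_eq0 pnatr_eq0 -lt0n card_gt0; apply/set0Pn; exists x.
Qed.

Section SelfComplementary.
Variables (C : {set 'rV['Z_2]_n}) (selfC : self_complementary C).

Lemma degree_gt0_length : (0 < degree C)%N -> (0 < n)%N.
Proof.
rewrite card_gt0 => /set0Pn[i /distancesP[i_gt0 _]].
by rewrite -ltnS (leq_ltn_trans i_gt0).
Qed.

(** A codeword and its complement are at distance [n]. Positive degree supplies a codeword and also
    [n > 0]; for [n = 0] the index [ord_max] would be the excluded 0. *)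
Lemma distances_length : (0 < degree C)%N -> ord_max \in distances C.
Proof.
move=> deg_gt0; have n_gt0 := degree_gt0_length deg_gt0.
move: deg_gt0; rewrite card_gt0 => /set0Pn[i /distancesP[_ [x [_ [Cx _ _]]]]].
apply/distancesP; split=> //=; exists x, (x + const_mx 1).
split; rewrite ?selfC //.
rewrite hamming_dist_complement (eqP (_ : hamming_dist x x == 0%N)) ?subn0 //.
by rewrite hamming_dist_eq0.
Qed.

Lemma card_proper_distances : #|distances C :\ ord_max| = (degree C).-1.
Proof.
(* In degree 0 the truncated predecessor is still correct. *)
rewrite /degree; have [->|/set0Pn[i Di]] := eqVneq (distances C) set0.
  by rewrite set0D cards0.
have deg_gt0 : (0 < degree C)%N by rewrite card_gt0; apply/set0Pn; exists i.
by rewrite (cardsD1 ord_max (distances C)) distances_length.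
Qed.

(** [rev_ord] maps [d] to [n - d], attained by complementing one word. It swaps 0 and [n], both of
    which are excluded from the set. *)
Lemma rev_distances i :
  (rev_ord i \in distances C :\ ord_max) = (i \in distances C :\ ord_max).
Proof.
suff rev_impl k : k \in distances C :\ ord_max ->
    rev_ord k \in distances C :\ ord_max.
  by apply/idP/idP => /rev_impl //; rewrite rev_ordK.
rewrite in_setD1 -val_eqE /= => /andP[neq_kn /distancesP[k_gt0 [x [y [Cx Cy dxy]]]]].
have lt_kn : (k < n)%N by rewrite ltn_neqAle neq_kn -ltnS ltn_ord.
rewrite in_setD1 -val_eqE /= subSS ltn_eqF ?ltn_subrL ?k_gt0 //=;
  last by rewrite (leq_trans k_gt0) // ltnW.
apply/distancesP; split; first by rewrite /= subSS subn_gt0.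
exists x, (y + const_mx 1); split; rewrite ?selfC //.
by rewrite hamming_dist_complement dxy /= subSS.
Qed.

End SelfComplementary.
End Distances.

(** * The reduced annihilator: degree, symmetry, zeros, parity of its expansion *)

Section Annihilator.
Variables (n : nat) (C : {set 'rV['Z_2]_n}) (selfC : self_complementary C).

Lemma size_reduced_annihilator (R : fieldType) :
  (0 < degree C)%N -> (size (reduced_annihilator R C) <= degree C)%N.
Proof.
move=> deg_gt0; rewrite -(prednK deg_gt0) -card_proper_distances //.
rewrite /reduced_annihilator -sum1_card.
elim/big_ind2: _ => [|p a q b szp szq|i _]; first by rewrite size_poly1.
  rewrite (leq_trans (size_polyMleq _ _)) // -subn1 leq_subLR.
  by rewrite (leq_trans (leq_add szp szq)) // addSn addnS.
rewrite (leq_trans (size_polyD _ _)) // geq_max size_poly1 size_polyN /=.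
by rewrite (leq_trans (size_scale_leq _ _)) // size_polyX.
Qed.

(* The roots are symmetric about [n / 2], because [n - d(x, y) = d(x, y + 1)]. *)
Lemma reduced_annihilator_reflect (R : numFieldType) :
  reduced_annihilator R C \Po (n%:R%:P - 'X) =
    (-1) ^+ (degree C).-1 *: reduced_annihilator R C.
Proof.
rewrite -card_proper_distances // /reduced_annihilator; set S := _ :\ _.
have S_gt0 i : i \in S -> (0 < i)%N.
  by rewrite in_setD1 => /andP[_ /distancesP[]].
have S_rev i : (rev_ord i \in S) = (i \in S) by apply: rev_distances.
rewrite rmorph_prod /=.
(* Factorwise, [1 - (n - X)/i = -((n - i)/i) (1 - X/(n - i))]. *)
transitivity (\prod_(i in S) ((- ((rev_ord i)%:R / i%:R)) *:
    (1 - (rev_ord i)%:R^-1 *: 'X : {poly R}))).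
  apply: eq_bigr => i Si; have i_neq0 : i%:R != 0 :> R.
    by rewrite pnatr_eq0 -lt0n S_gt0.
  have r_neq0 : (rev_ord i)%:R != 0 :> R.
    by rewrite pnatr_eq0 -lt0n S_gt0 // S_rev.
  have def_n : n%:R = i%:R + (rev_ord i)%:R :> R.
    by rewrite -natrD /= subSS subnKC // -ltnS.
  rewrite comp_polyB comp_polyZ comp_polyX -polyC1 comp_polyC.
  rewrite !scalerBr scalerA mulNr [_ / _ / _]mulrAC divff // mul1r !scaleNr opprK.
  rewrite opprB addrCA addrC; congr (_ + _).
  rewrite polyC1 -[n%:R%:P]alg_polyC scalerA def_n mulrDr mulVf // scalerDl scale1r.
  by rewrite opprD addNKr mulrC.
(* Since [i -> n - i] permutes [S], the ratios [(n - i)/i] multiply to 1 and only the signs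
   remain. *)
rewrite scaler_prod; congr (_ *: _).
  rewrite prodrN -[RHS]mulr1; congr (_ * _).
  rewrite big_split (reindex_inj rev_ord_inj).
  rewrite prodfV; under eq_bigl => i do rewrite S_rev.
  under eq_bigr => i _ do rewrite rev_ordK.
  apply: divff; apply/prodf_neq0 => i Si.
  by rewrite pnatr_eq0 -lt0n S_gt0.
rewrite (reindex_inj rev_ord_inj); apply: eq_big => i; first by rewrite S_rev.
by rewrite rev_ordK.
Qed.

Lemma reduced_annihilator0 (R : fieldType) : (reduced_annihilator R C).[0] = 1.
Proof.
rewrite horner_prod big1 // => i _.
by rewrite hornerD hornerN hornerZ hornerX hornerC mulr0 subr0.
Qed.

Lemma reduced_annihilator_dist (R : numFieldType) x y :
  x \in C -> y \in C -> hamming_dist x y != 0%N -> hamming_dist x y != n ->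
  (reduced_annihilator R C).[(hamming_dist x y)%:R] = 0.
Proof.
move=> Cx Cy d_neq0 d_neqn; set d := hamming_dist x y.
have lt_d : (d < n.+1)%N by rewrite ltnS hamming_dist_leq.
rewrite horner_prod (bigD1 (Ordinal lt_d)) /=.
  by rewrite !hornerE mulVf ?subrr ?mul0r // pnatr_eq0.
rewrite in_setD1 -val_eqE /= d_neqn; apply/distancesP.
by split=> /=; [rewrite lt0n | exists x, y].
Qed.

Lemma krawtchouk_expansion_parity (R : numFieldType) (alpha : nat -> R) i :
  krawtchouk_expansion C alpha -> (i < degree C)%N ->
  odd i != odd (degree C).-1 -> alpha i = 0.
Proof.
move=> exp_alpha lt_i odd_i.
(* Reflecting the expansion in two ways gives a vanishing combination with coefficients [b k]. When
   the parities differ, the two signs differ, which forces [alpha k = 0]. *)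
pose b k := (-1) ^+ k * alpha k - (-1) ^+ (degree C).-1 * alpha k.
have: b i = 0.
  apply: (graded_poly_free (size_krawtchouk R n)) lt_i.
  have := reduced_annihilator_reflect R.
  rewrite exp_alpha raddf_sum scaler_sumr => /eqP.
  rewrite -subr_eq0 -sumrB => /eqP sum0.
  rewrite -[RHS]sum0.
  apply: eq_bigr => k _.
  by rewrite /= comp_polyZ krawtchouk_reflect !scalerA scalerBl mulrC.
rewrite /b -signr_odd -[X in _ - X * _]signr_odd -mulrBl => /eqP.
rewrite mulf_eq0 => /orP[|/eqP //]; rewrite subr_eq0.
by rewrite (inj_eq (@signr_inj R)) (negbTE odd_i).
Qed.

End Annihilator.

(** * Double counting over pairs of codewords, and the bound *)

Lemma sum_annihilator_krawtchouk (R : numFieldType) n (C : {set 'rV['Z_2]_n}) k :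
  self_complementary C -> (0 < degree C)%N -> odd k = odd (degree C).-1 ->
  \sum_(x in C) \sum_(y in C) (reduced_annihilator R C).[(hamming_dist x y)%:R] *
      (krawtchouk R n k).[(hamming_dist x y)%:R] =
    #|C|%:R * (2 * 'C(n, k)%:R).
Proof.
move=> selfC deg_gt0 odd_k; have n_gt0 := degree_gt0_length deg_gt0.
rewrite mulr_natl -sumr_const; apply: eq_bigr => x Cx.
have dist_xx : hamming_dist x x = 0%N by apply/eqP; rewrite hamming_dist_eq0.
have dist_xx1 : hamming_dist x (x + const_mx 1) = n.
  by rewrite hamming_dist_complement dist_xx subn0.
have neq_xx1 : x + const_mx 1 != x.
  by rewrite eq_sym -hamming_dist_eq0 dist_xx1 -lt0n.
rewrite (bigD1 x) //= (bigD1 (x + const_mx 1)) ?selfC //= big1 => [|y].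
  rewrite dist_xx dist_xx1 reduced_annihilator0 krawtchouk_at0 mul1r addr0.
  (* The values at [n] come from evaluating the reflection identities at 0. *)
  have := congr1 (fun p : {poly R} => p.[0]) (reduced_annihilator_reflect selfC R).
  rewrite horner_comp hornerZ reduced_annihilator0 !hornerE subr0 => ->.
  have := congr1 (fun p : {poly R} => p.[0]) (krawtchouk_reflect R n k).
  rewrite horner_comp hornerZ krawtchouk_at0 !hornerE subr0 => ->.
  rewrite mulrA -signr_odd -[X in _ * X * _]signr_odd odd_k -expr2 sqrr_sign.
  by rewrite mul1r mulr2n mulrDl mul1r.
case/andP=> /andP[Cy neq_yx] neq_yx1.
rewrite reduced_annihilator_dist ?mul0r //; first by rewrite hamming_dist_eq0 eq_sym.
(* A word at distance [n] from [x] has complement at distance 0, hence is the complement of [x]. *)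
apply: contraNneq neq_yx1 => dxy.
have : hamming_dist x (y + const_mx 1) == 0%N.
  by rewrite hamming_dist_complement dxy subnn.
rewrite hamming_dist_eq0 => /eqP ->; apply/eqP/rowP => j; rewrite !mxE.
by case: (y 0 j) => [[|[|b]] ltb]; apply: val_inj.
Qed.

Theorem theorem3p4 (R : archiRealFieldType) (n : nat)
    (C : {set 'rV['Z_2]_n}) (s : nat)
    (selfC : self_complementary C) (degC : degree C = s) :
  let delta : nat := if odd s then 0%N else 1%N in
  [/\ (0 < s)%N -> exists alpha : nat -> R, krawtchouk_expansion C alpha,
      forall alpha beta : nat -> R,
        krawtchouk_expansion C alpha -> krawtchouk_expansion C beta ->
        forall i : nat, (i < s)%N -> alpha i = beta i
    & forall alpha : nat -> R, krawtchouk_expansion C alpha ->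
        (forall i : nat, (i < s)%N -> i <> s.-1 %[mod 2] -> alpha i = 0)
        /\ ((forall i : nat, (i < s)%N -> i = s.-1 %[mod 2] -> 0 <= alpha i) ->
            0 < alpha delta ->
            #|C|%:Z <= Num.floor (2 / alpha delta))].
Proof.
rewrite -{s}degC; set s := degree C; move=> delta; split.
- move=> s_gt0; apply: (graded_poly_span (size_krawtchouk R n)).
  exact: size_reduced_annihilator.
- move=> alpha beta exp_alpha exp_beta i lt_is.
  apply/eqP; rewrite -subr_eq0; apply/eqP.
  apply: (graded_poly_free (a := fun i => alpha i - beta i)
    (size_krawtchouk R n)) lt_is.
  under eq_bigr => k _ do rewrite scalerBl.
  by rewrite sumrB -exp_alpha -exp_beta subrr.
move=> alpha exp_alpha.
have parity i : (i < s)%N -> i <> s.-1 %[mod 2] -> alpha i = 0.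
  move=> lt_is; rewrite !modn2 => odd_i.
  apply: krawtchouk_expansion_parity exp_alpha lt_is _ => //.
  by apply/eqP => /(congr1 nat_of_bool).
split=> // alpha_ge0 alpha_gt0.
(* For [s = 0] the expansion is an empty sum, while the reduced annihilator takes the value 1 at
   0. *)
have s_gt0 : (0 < s)%N.
  rewrite lt0n; apply/eqP => s0; have := reduced_annihilator0 C R.
  rewrite exp_alpha -/s s0 big_ord0 horner0 => /eqP.
  by rewrite eq_sym oner_eq0.
have n_gt0 := degree_gt0_length s_gt0.
(* A positive even [s] is at least 2, so [delta] is a valid index; [delta <= n] makes the binomial
   positive, hence cancellable at the end. *)
have [lt_ds odd_d le_dn] : [/\ (delta < s)%N, odd delta = odd s.-1 & (delta <= n)%N].
  rewrite -subn1 oddB // addbT /delta; case odd_s: (odd s); split=> //.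
  by case: (s) s_gt0 odd_s => [|[]].
have all_ge0 i : (i < s)%N -> 0 <= alpha i.
  move=> lt_is; have [/eqP eq_i | /eqP neq_i] := boolP (i %% 2 == s.-1 %% 2)%N.
    exact: alpha_ge0.
  by rewrite parity.
rewrite floor_ge_int ler_pdivlMr //.
have bin_gt0 : 0 < 'C(n, delta)%:R :> R by rewrite ltr0n bin_gt0.
have [C0 | C_gt0] := posnP #|C|; first by rewrite C0 mul0r.
have := sum_annihilator_krawtchouk R selfC s_gt0 odd_d.
pose G i := \sum_(x in C) \sum_(y in C) (krawtchouk R n i).[(hamming_dist x y)%:R] *
  (krawtchouk R n delta).[(hamming_dist x y)%:R].
have -> : \sum_(x in C) \sum_(y in C)
    (reduced_annihilator R C).[(hamming_dist x y)%:R] *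
      (krawtchouk R n delta).[(hamming_dist x y)%:R] = \sum_(i < s) alpha i * G i.
  under [RHS]eq_bigr => i _ do rewrite mulr_sumr.
  rewrite [RHS]exchange_big; apply: eq_bigr => x _ /=.
  under [RHS]eq_bigr => i _ do rewrite mulr_sumr.
  rewrite [RHS]exchange_big; apply: eq_bigr => y _ /=.
  rewrite exp_alpha horner_sum mulr_suml; apply: eq_bigr => i _.
  by rewrite hornerZ mulrA.
move=> sum_eq.
(* All terms [alpha i * G i] are nonnegative; keep only [i = delta] and bound [G delta] from below
   by its diagonal part. *)
have: alpha delta * ('C(n, delta)%:R * #|C|%:R ^+ 2) <=
    #|C|%:R * (2 * 'C(n, delta)%:R).
  rewrite -sum_eq (bigD1 (Ordinal lt_ds)) //= ler_wpDr //.
    by apply: sumr_ge0 => i _; rewrite mulr_ge0 ?all_ge0 ?sum_krawtchoukM_ge0.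
  by rewrite ler_wpM2l ?sum_krawtchouk_sqr_ge // ltW.
rewrite [leRHS]mulrA [leRHS]mulrC mulrCA ler_pM2l // expr2 mulrA.
by rewrite [leRHS]mulrC ler_pM2r ?ltr0n // mulrC.
Qed.
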